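(* For $n=1$ and for $n=2$ the group $\mathrm{Isom}_e(K_0(\mathbb{P}_n))$ is isomorphic to $\mathbb{Z}$ and is generated by the twisting $E\mapsto E(1)=E\otimes\mathcal{O}(1)$.
   Context: $K_0(\mathbb{P}_n)$ is the Grothendieck group of coherent sheaves on the $n$-dimensional projective space $\mathbb{P}_n$ over a fixed ground field; it is a free $\mathbb{Z}$-module of rank $n+1$ with basis the classes of $\mathcal{O},\mathcal{O}(1),\dots,\mathcal{O}(n)$. A sheaf and its class are denoted by the same letter. The Euler form is the (nonsymmetric) nondegenerate bilinear form $\chi(E,F)=\sum_\nu(-1)^\nu\dim\mathrm{Ext}^\nu(E,F)$; it satisfies $\chi(\mathcal{O}(k),\mathcal{O}(m))=\binom{n+m-k}{n}$ for all $k,m\in\mathbb{Z}$, where $\binom{x}{n}=\frac{x(x-1)\cdots(x-n+1)}{n!}$. It is extended $\mathbb{R}$-bilinearly to $K_0(\mathbb{P}_n)\otimes\mathbb{R}$. $\mathrm{Isom}(K_0(\mathbb{P}_n))$ is the group of $\mathbb{Z}$-linear automorphisms of $K_0(\mathbb{P}_n)$ preserving $\chi$; $\mathrm{Isom}(K_0(\mathbb{P}_n)\otimes\mathbb{R})\subset GL(n+1,\mathbb{R})$ is the group of $\mathbb{R}$-linear automorphisms of $K_0(\mathbb{P}_n)\otimes\mathbb{R}$ preserving $\chi$, and $\mathrm{Isom}_e(K_0(\mathbb{P}_n)\otimes\mathbb{R})$ is its connected component of the identity. Regarding $\mathrm{Isom}(K_0(\mathbb{P}_n))$ as a subgroup of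 $\mathrm{Isom}(K_0(\mathbb{P}_n)\otimes\mathbb{R})$, one sets $\mathrm{Isom}_e(K_0(\mathbb{P}_n))=\mathrm{Isom}(K_0(\mathbb{P}_n))\cap \mathrm{Isom}_e(K_0(\mathbb{P}_n)\otimes\mathbb{R})$. The symbol $\otimes$ between classes denotes the commutative ring structure on $K_0(\mathbb{P}_n)$ induced by tensor product of locally free sheaves; it is the bilinear product with $\mathcal{O}(k)\otimes\mathcal{O}(m)=\mathcal{O}(k+m)$ for all $k,m\in\mathbb{Z}$. *)

(* Defs.v *)
From HB Require Import structures.
From mathcomp Require Import all_boot all_order all_algebra.
From mathcomp Require Import qpoly ring zify.
From mathcomp Require Import all_classical all_reals all_analysis.

Set Implicit Arguments.
Unset Strict Implicit.
Unset Printing Implicit Defensive.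

Import Order.TTheory GRing.Theory Num.Theory.
Import numFieldNormedType.Exports.

Local Open Scope classical_set_scope.
Local Open Scope ring_scope.

(* x (x - 1) ... (x - n + 1) / n! *)
Definition binq (x : int) (n : nat) : rat :=
  (\prod_(i < n) (x - i%:Z)%:~R) / n`!%:R.

(* The Grothendieck ring of P_n with its Euler form, described by the
   properties that determine it up to a unique isomorphism: K0 is free over Z
   on O(0), ..., O(n), [*] is the tensor product, and [coord E] is the row of
   coordinates of E in that basis. *)
Record K0_Pn (n : nat) := {
  K0 :> comNzRingType;
  twO : int -> K0;
  coord : K0 -> 'rV[int]_n.+1;
  chi : K0 -> K0 -> int;
  twO_mul : forall k m : int, twO k * twO m = twO (k + m);
  coordK : forall E, \sum_(i < n.+1) twO i%:Z *~ coord E 0 i = E;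
  combK : forall c : 'rV[int]_n.+1,
    coord (\sum_(i < n.+1) twO i%:Z *~ c 0 i) = c;
  chiDl : forall E E' F : K0, chi (E + E') F = chi E F + chi E' F;
  chiDr : forall E F F' : K0, chi E (F + F') = chi E F + chi E F';
  chi_twO : forall k m : int,
    (chi (twO k) (twO m))%:~R = binq (n%:Z + m - k) n
}.

Section Isometries.
Context (R : realType) (n : nat) (K : K0_Pn n).

Definition isom_K0 : set (K -> K) :=
  [set f : K -> K | [/\ {morph f : E F / E + F}, bijective f
             & forall E F, chi (f E) (f F) = chi E F]].

(* K0 (x) R is 'rV[R]_n.+1, where v stands for \sum_i v_i O(i). *)
Definition chiR (u v : 'rV[R]_n.+1) : R :=
  \sum_(i < n.+1) \sum_(j < n.+1)
     u 0 i * v 0 j * (chi (twO K i%:Z) (twO K j%:Z))%:~R.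

(* A matrix A stands for the automorphism v |-> v *m A. *)
Definition isom_K0R : set 'M[R]_n.+1 :=
  [set A : 'M[R]_n.+1 | A \in unitmx
     /\ forall u v, chiR (u *m A) (v *m A) = chiR u v].

Definition isom_e_K0R : set 'M[R]_n.+1 := connected_component isom_K0R 1%:M.

(* The matrix of f (x) R: its i-th row is the image of O(i). *)
Definition extR (f : K -> K) : 'M[R]_n.+1 :=
  \matrix_(i, j) (coord (f (twO K i%:Z)) 0 j)%:~R.

Definition isom_e_K0 : set (K -> K) :=
  [set f : K -> K | isom_K0 f /\ isom_e_K0R (extR f)].

Definition twist (E : K) : K := E * twO K 1.

End Isometries.

Arguments isom_K0 {n} K _.
Arguments isom_K0R R {n} K _.
Arguments isom_e_K0R R {n} K _.
Arguments isom_e_K0 R {n} K _.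
Arguments twist {n} K E.

(* Groups of bijections T -> T under composition. *)
Definition transf_group (T : Type) (G : set (T -> T)) : Prop :=
  [/\ G id, forall f g, G f -> G g -> G (f \o g)
    & forall f, G f -> exists g, [/\ G g, cancel f g & cancel g f]].

Definition generated_by (T : Type) (g : T -> T) : set (T -> T) :=
  smallest (@transf_group T) [set g].

Definition isomorphic_to_Z (T : Type) (G : set (T -> T)) : Prop :=
  exists phi : int -> (T -> T),
    set_bij [set: int] G phi /\ forall a b, phi (a + b) = phi a \o phi b.

(* K0_Pn n is inhabited by Z[X] / (X - 1)^(n+1), where O(k) = X^k. The values
   of chi outside the basis follow from the fact that both sides of [chi_twO]
   are killed by the (n+1)-st finite difference in k and in m. *)

Lemma binq_pascal (x : int) (n : nat) :
  binq (x + 1) n.+1 = binq x n.+1 + binq x n.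
Proof.
rewrite /binq big_ord_recl big_ord_recr /=.
rewrite (eq_bigr (fun i : 'I_n => (x - i%:Z)%:~R)) => [|i _]; last first.
  by congr _%:~R; rewrite /bump; lia.
set P := \prod_(i < n) _; rewrite factS natrM.
have f0 : (n`!%:R : rat) != 0 by rewrite pnatr_eq0 -lt0n fact_gt0.
have n0 : (n.+1%:R : rat) != 0 by rewrite pnatr_eq0.
rewrite subr0 rmorphD rmorphB /= -!pmulrn.
have n0' : 1 + n%:R != 0 :> rat by rewrite nat1r.
by rewrite -(nat1r n); field; rewrite f0.
Qed.

Lemma binq0 x : binq x 0 = 1.
Proof. by rewrite /binq big_ord0 fact0 divr1. Qed.

Lemma binq_nat (m n : nat) : binq m%:Z n = 'C(m, n)%:R.
Proof.
elim: m n => [|m IH] [|n]; rewrite ?binq0 ?bin0 //.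
  by rewrite bin0n /binq big_ord_recl /= subr0 mul0r mul0r.
by rewrite -[m.+1]addn1 PoszD binq_pascal !IH addn1 binS natrD.
Qed.

Fixpoint fdiff (N : nat) (s : int -> rat) : int -> rat :=
  if N is N'.+1 then fdiff N' (fun k => s (k + 1) - s k) else s.

Lemma fdiffS N s k :
  fdiff N.+1 s k = fdiff N (fun k => s (k + 1) - s k) k.
Proof. by []. Qed.

Lemma fdiff_ext N s t : s =1 t -> fdiff N s =1 fdiff N t.
Proof. by elim: N s t => //= N IH s t st; apply: IH => k; rewrite !st. Qed.

Lemma fdiffN N s k : fdiff N (fun k => - s k) k = - fdiff N s k.
Proof.
elim: N s k => //= N IH s k; rewrite -IH; apply: fdiff_ext => j.
by rewrite opprB opprK addrC.
Qed.

Lemma fdiffB N s t k :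
  fdiff N (fun k => s k - t k) k = fdiff N s k - fdiff N t k.
Proof.
elim: N s t k => //= N IH s t k; rewrite -IH; apply: fdiff_ext => j; ring.
Qed.

Lemma fdiff_eq0 N s : fdiff N s =1 (fun=> 0) ->
  (forall i : nat, (i < N)%N -> s i%:Z = 0) -> s =1 (fun=> 0).
Proof.
elim: N s => //= N IH s /IH ds s0.
have {}ds k : s (k + 1) = s k.
  apply/subr0_eq/ds => i iN.
  by rewrite -PoszD addn1 !s0 ?subrr // ltnW.
elim/int_rect => [|k <-|k <-]; first exact: s0.
- by rewrite -addn1 PoszD ds.
- by rewrite -ds; congr s; lia.
Qed.

Lemma fdiff_binq (n : nat) c k : fdiff n.+1 (fun k => binq (c + k) n) k = 0.
Proof.
elim: n c k => [|n IH] c k; first by rewrite /= !binq0 subrr.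
rewrite fdiffS -[RHS](IH c k); apply: fdiff_ext => j.
by rewrite addrA binq_pascal addrAC subrr add0r.
Qed.

Lemma fdiff_binqN (n : nat) c k : fdiff n.+1 (fun k => binq (c - k) n) k = 0.
Proof.
elim: n c k => [|n IH] c k; first by rewrite /= !binq0 subrr.
rewrite fdiffS -[RHS]oppr0 -[in RHS](IH (c - 1) k) -[RHS]fdiffN.
apply: fdiff_ext => j.
have -> : c - j = (c - 1 - j) + 1 by ring.
have -> : c - (j + 1) = c - 1 - j by ring.
by rewrite binq_pascal; ring.
Qed.

Section Model.
Variable n : nat.
Definition qmod : {poly int} := ('X - 1) ^+ n.+1.
Local Notation h := qmod.
Local Notation A := {poly %/ h}.

Lemma monic_h : h \is monic.
Proof. by rewrite /qmod monic_exp // -(polyC1 int) monicXsubC. Qed.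

Lemma size_h : size h = n.+2.
Proof. by rewrite /qmod -(polyC1 int) size_exp_XsubC. Qed.

Lemma mk_monic_h : mk_monic h = h.
Proof. by rewrite /mk_monic size_h monic_h. Qed.

Definition qx : A := in_qpoly h 'X.

Lemma qx_nilp : (qx - 1) ^+ n.+1 = 0.
Proof.
rewrite /qx -(in_qpoly1 h) -(rmorphB (in_qpoly h)) -(rmorphXn (in_qpoly h)).
apply/val_inj; rewrite /= mk_monic_h.
by rewrite Pdiv.RingMonic.rmodpp ?monic_h.
Qed.

Definition qxV : A := \sum_(i < n.+1) (1 - qx) ^+ i.

Lemma qxVx : qx * qxV = 1.
Proof.
have := subrX1 (1 - qx) n.+1; rewrite -/qxV.
have -> : (1 - qx) ^+ n.+1 = 0.
  by rewrite -opprB exprNn qx_nilp mulr0.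
rewrite sub0r addrAC subrr add0r mulNr => /oppr_inj. by [].
Qed.

Definition qxz (k : int) : A :=
  match k with Posz m => qx ^+ m | Negz m => qxV ^+ m.+1 end.

Lemma qxzS k : qxz (k + 1) = qxz k * qx.
Proof.
case: k => m; first by rewrite -PoszD addn1 /= exprSr.
case: m => [|m]; first by rewrite /= mulrC qxVx.
have -> : Negz m.+1 + 1 = Negz m by lia.
by rewrite /= [in RHS]exprSr -mulrA [qxV * _]mulrC qxVx mulr1.
Qed.

Lemma qxzP k : qxz (k - 1) = qxz k * qxV.
Proof. by rewrite -{2}(subrK 1 k) qxzS -mulrA qxVx mulr1. Qed.

Lemma qxz_mul k m : qxz k * qxz m = qxz (k + m).
Proof.
elim/int_rect: m => [|m IH|m IH]; first by rewrite mulr1 addr0.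
- by rewrite -addn1 PoszD qxzS mulrA IH addrA qxzS.
- rewrite -addn1 PoszD opprD qxzP mulrA IH addrA qxzP //.
Qed.

Definition qcoord (E : A) : 'rV[int]_n.+1 := \row_i E`_i.

Lemma qxE (i : nat) : (i <= n)%N -> qxz i = 'X^i :> {poly int}.
Proof.
move=> le_in; rewrite /= -(rmorphXn (in_qpoly h)) in_qpoly_small //.
by rewrite size_polyXn mk_monic_h size_h.
Qed.

Lemma qcombE (c : 'rV[int]_n.+1) :
  \sum_(i < n.+1) qxz i%:Z *~ c 0 i
    = \sum_(i < n.+1) c 0 i *: 'X^i :> {poly int}.
Proof.
rewrite poly_of_qpoly_sum; apply: eq_bigr => i _.
rewrite (raddfMz (polyn (n := _))) [X in X *~ _](@qxE i) ?leq_ord //.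
by rewrite -scaler_int intz.
Qed.

Lemma qcombK : forall c : 'rV[int]_n.+1,
    qcoord (\sum_(i < n.+1) qxz i%:Z *~ c 0 i) = c.
Proof.
move=> c; apply/rowP => j; rewrite mxE qcombE coef_sum.
rewrite (bigD1 j) //= big1 => [|i /negPf ij]; rewrite coefZ coefXn.
  by rewrite eqxx mulr1 addr0.
by rewrite eq_sym (inj_eq val_inj) ij mulr0.
Qed.

Lemma qcoordK : forall E, \sum_(i < n.+1) qxz i%:Z *~ qcoord E 0 i = E.
Proof.
move=> E; apply/val_inj; rewrite [LHS]qcombE.
under eq_bigr => i _ do rewrite mxE.
apply/polyP => j; rewrite coef_sum.
case: (ltnP j n.+1) => [jn|nj].
  rewrite (bigD1 (Ordinal jn)) //= big1 => [|i /negPf ij]; rewrite coefZ coefXn.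
    by rewrite eqxx mulr1 addr0.
  by rewrite eq_sym -[j]/(val (Ordinal jn)) (inj_eq val_inj) ij mulr0.
rewrite big1 => [|i _]; last first.
  by rewrite coefZ coefXn gtn_eqF ?mulr0 // (leq_trans (ltn_ord i)).
rewrite nth_default // -ltnS.
by apply: leq_trans (size_mk_monic E) _; rewrite mk_monic_h size_h.
Qed.

Definition qchi (E F : A) : int :=
  \sum_(i < n.+1) \sum_(j < n.+1) E`_i * F`_j * 'C(n + j - i, n)%:Z.

Lemma qcoefD (E F : A) i : (E + F)`_i = E`_i + F`_i.
Proof. by rewrite -coefD. Qed.

Lemma qchiDl E E' F : qchi (E + E') F = qchi E F + qchi E' F.
Proof.
rewrite /qchi -big_split; apply: eq_bigr => i _ /=.
rewrite -big_split; apply: eq_bigr => j _ /=.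
by rewrite qcoefD !mulrDl.
Qed.

Lemma qchiDr E F F' : qchi E (F + F') = qchi E F + qchi E F'.
Proof.
rewrite /qchi -big_split; apply: eq_bigr => i _ /=.
rewrite -big_split; apply: eq_bigr => j _ /=.
by rewrite qcoefD mulrDr mulrDl.
Qed.

Lemma fdiff_qxz (f : A -> int) N k : {morph f : E F / E + F} ->
  forall a, fdiff N (fun k => (f (a * qxz k))%:~R) k
            = (f (a * (qx - 1) ^+ N * qxz k))%:~R.
Proof.
move=> fD.
have fB E F : f (E - F) = f E - f F.
  by apply/eqP; rewrite eq_sym subr_eq -fD subrK.
elim: N => [|N IH] a /=; first by rewrite mulr1.
rewrite exprS mulrA -IH; apply: fdiff_ext => j.
by rewrite qxzS -rmorphB -fB /=; congr (f _)%:~R; ring.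
Qed.

Lemma fdiff_qxz0 (f : A -> int) k : {morph f : E F / E + F} ->
  fdiff n.+1 (fun k => (f (qxz k))%:~R) k = 0.
Proof.
move=> fD; have /(_ 1) := @fdiff_qxz f n.+1 k fD.
rewrite qx_nilp mulr0 mul0r.
have -> : f 0 = 0 by apply: (addrI (f 0)); rewrite -fD !addr0.
rewrite mulr0z => <-.
by apply: fdiff_ext => j; rewrite mul1r.
Qed.

Lemma qx_coef (i j : nat) : (i <= n)%N -> (qx ^+ i)`_j = (j == i)%:R.
Proof. by move=> le_in; rewrite -coefXn -(qxE le_in). Qed.

Lemma qchi_small (i j : nat) : (i <= n)%N -> (j <= n)%N ->
  qchi (qxz i) (qxz j) = 'C(n + j - i, n)%:Z.
Proof.
move=> le_in le_jn; rewrite /qchi /=.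
have i' : (i < n.+1)%N by rewrite ltnS.
have j' : (j < n.+1)%N by rewrite ltnS.
rewrite (bigD1 (Ordinal i')) //= [X in _ + X]big1 => [|a /negPf ai]; last first.
  apply: big1 => b _; rewrite qx_coef //.
  by rewrite -[i]/(val (Ordinal i')) (inj_eq val_inj) ai !mul0r.
rewrite (bigD1 (Ordinal j')) //= [X in _ + X + _]big1 => [|b /negPf bj];
  last first.
  rewrite (qx_coef b le_jn).
  by rewrite -[j]/(val (Ordinal j')) (inj_eq val_inj) bj mulr0 mul0r.
by rewrite !qx_coef // !eqxx !mul1r !addr0.
Qed.

Lemma qchi_qxz k m : (qchi (qxz k) (qxz m))%:~R = binq (n%:Z + m - k) n.
Proof.
have step1 (i : nat) : (i <= n)%N -> forall m,
    (qchi (qxz i) (qxz m))%:~R = binq (n%:Z + m - i%:Z) n.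
  move=> le_in {}m; apply/subr0_eq; move: m; apply: (@fdiff_eq0 n.+1).
    move=> m; rewrite fdiffB fdiff_qxz0; last exact: qchiDr.
    rewrite -[X in _ - X](@fdiff_ext _ (fun m => binq ((n%:Z - i%:Z) + m) n)).
      by rewrite fdiff_binq subrr.
    by move=> l; rewrite addrAC.
  move=> j; rewrite ltnS => le_jn; rewrite qchi_small //.
  rewrite (_ : n%:Z + j%:Z - i%:Z = (n + j - i)%N%:Z) ?binq_nat ?subrr //; lia.
apply/subr0_eq; move: k; apply: (@fdiff_eq0 n.+1).
  move=> k; rewrite fdiffB.
  rewrite (@fdiff_qxz0 (fun E => qchi E (qxz m))); last first.
    by move=> E F; rewrite qchiDl.
  by rewrite fdiff_binqN subrr.
by move=> i; rewrite ltnS => le_in; rewrite step1 // subrr.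
Qed.

Definition K0_Pn_model : K0_Pn n :=
  Build_K0_Pn qxz_mul qcoordK qcombK qchiDl qchiDr qchi_qxz.

End Model.

(* Main.v *)
(** Work in the basis O(0), ..., O(n) and let M(t) be the matrix of the twist
    by O(t), whose entries are polynomials in t and hence make sense for real t.
    An isometry commutes with the Serre operator, which up to sign is
    M(n + 1); for n = 1, 2 this is unipotent up to sign with a single Jordan
    block, so an isometry is multiplication by the image of O. The remaining
    quadratic equations force it to be s M(b) with s = 1 or -1 and b real. The
    rank s of the image of O is continuous on the isometries, so it is 1 on the
    identity component, which is therefore {M(b)}. If M(b) is integral then so
    is b, the degree of the image of O. *)

From HB Require Import structures.
From mathcomp Require Import all_boot all_order all_algebra ring lra zify.
From mathcomp Require Import all_classical all_reals all_analysis.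
Require Import Defs.

Set Implicit Arguments.
Unset Strict Implicit.
Unset Printing Implicit Defensive.

Import Order.TTheory GRing.Theory Num.Theory.
Import numFieldNormedType.Exports.

Local Open Scope classical_set_scope.
Local Open Scope ring_scope.

(** Indices are spelled as [big_ord_recl] produces them, so that expanded sums match the entry
    rules. *)
Local Notation o0 := (@ord0 _).
Local Notation o1 := (lift ord0 (@ord0 _)).
Local Notation o2 := (lift ord0 (lift ord0 (@ord0 _))).

Lemma ord2_ind (P : 'I_2 -> Prop) :
  P o0 -> P o1 -> forall i, P i.
Proof.
move=> P0 P1 i; case: (unliftP ord0 i) => [j ->|->] //.
by rewrite (ord1 j).
Qed.

Lemma ord3_ind (P : 'I_3 -> Prop) :
  P o0 -> P o1 -> P o2 -> forall i, P i.
Proof.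
move=> P0 P1 P2 i; case: (unliftP ord0 i) => [j ->|->] //.
by move: j; apply: ord2_ind.
Qed.

(** * The Grothendieck ring *)

Section K0Ring.
Context (n : nat) (K : K0_Pn n).
Implicit Types E F : K.

Lemma K0_additiveE (V : zmodType) (g : K -> V) :
  {morph g : E F / E + F} ->
  forall E, g E = \sum_(i < n.+1) g (twO K i%:Z) *~ coord E 0 i.
Proof.
move=> gD E.
have gB : zmod_morphism g.
  by move=> x y; apply/eqP; rewrite eq_sym subr_eq -gD subrK.
pose ga : {additive K -> V} := HB.pack g (GRing.isZmodMorphism.Build _ _ g gB).
rewrite -{1}(coordK E) -[g]/(ga : _ -> _) raddf_sum.
by apply: eq_bigr => i _; rewrite raddfMz.
Qed.

Lemma K0_additive_eq (V : zmodType) (g h : K -> V) :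
  {morph g : E F / E + F} -> {morph h : E F / E + F} ->
  (forall i : 'I_n.+1, g (twO K i%:Z) = h (twO K i%:Z)) -> g =1 h.
Proof.
move=> gD hD gh E; rewrite (K0_additiveE gD) (K0_additiveE hD).
by apply: eq_bigr => i _; rewrite gh.
Qed.

Lemma coord_inj : injective (@coord n K).
Proof. by move=> E F EF; rewrite -[E]coordK EF coordK. Qed.

(** By [twO_mul], multiplication by O(0) fixes each basis element, hence also the unit of the
    ring. *)
Lemma twO0 : twO K 0 = 1.
Proof.
rewrite -[LHS]mulr1 -[RHS]mul1r.
apply: (K0_additive_eq (g := fun E => twO K 0 * E) (h := fun E => 1 * E)).
- by move=> E F; rewrite mulrDr.
- by move=> E F; rewrite mulrDr.
- by move=> i; rewrite twO_mul add0r mul1r.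
Qed.

Lemma chi_twO_nat (i j : nat) : (i <= n)%N ->
  chi (twO K i%:Z) (twO K j%:Z) = 'C(n + j - i, n)%:Z.
Proof.
move=> le_in; apply: (@intr_inj rat); rewrite chi_twO.
by rewrite (_ : _ - _ = (n + j - i)%N%:Z) ?binq_nat //; lia.
Qed.

(** By biadditivity only the basis matters, and there chi depends only on the difference of the two
    degrees. *)
Lemma chi_twist (k : int) E F : chi (E * twO K k) (F * twO K k) = chi E F.
Proof.
move: E; apply: K0_additive_eq => [E E'|E E'|i]; rewrite ?mulrDl ?chiDl //.
move: F; apply: K0_additive_eq => [E E'|E E'|j]; rewrite ?mulrDl ?chiDr //.
apply: (@intr_inj rat); rewrite !twO_mul !chi_twO.
by congr (binq _ n); ring.
Qed.

Lemma twist_isom (k : int) : isom_K0 K (fun E => E * twO K k).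
Proof.
split; [by move=> E F; rewrite mulrDl | | exact: chi_twist].
by exists (fun E => E * twO K (- k)) => E;
  rewrite -mulrA twO_mul ?subrr ?addNr twO0 mulr1.
Qed.

End K0Ring.

(** * The one-parameter group of real twists *)

Section RealTwists.
Context (R : realType).

(* The coefficient of O(j) in O(t), extended from integral to real t: a
   Lagrange basis polynomial for the nodes 0, ..., n. *)
Definition lag (n : nat) (t : R) (j : nat) : R :=
  \prod_(k < n.+1 | k != j :> nat) ((t - k%:R) / (j%:R - k%:R)).

(** Row i holds the coordinates of O(t + i), in the row convention of [extR]. *)
Definition twist_mx (n : nat) (t : R) : 'M[R]_n.+1 :=
  \matrix_(i, j) lag n (t + i%:R) j.

(** The entries are chi(O(i), O(j)); the natural subtraction is exact because i <= n. *)
Definition gram (n : nat) : 'M[R]_n.+1 :=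
  \matrix_(i, j) 'C(n + j - i, n)%:R.

Lemma lag1E t : (lag 1 t 0 = 1 - t) * (lag 1 t 1 = t).
Proof.
by split; rewrite /lag big_mkcond !big_ord_recl big_ord0 ?lift0 /=; field.
Qed.

Lemma lag2E t : (lag 2 t 0 = (t - 1) * (t - 2) / 2)
  * (lag 2 t 1 = t * (2 - t)) * (lag 2 t 2 = t * (t - 1) / 2).
Proof.
by do !split; rewrite /lag big_mkcond !big_ord_recl big_ord0 ?lift0 /=; field.
Qed.

Lemma trmx_entry m p (A : 'M[R]_(m, p)) i j : A^T i j = A j i.
Proof. by rewrite mxE. Qed.

Lemma scalemx_entry m p (a : R) (A : 'M[R]_(m, p)) i j :
  (a *: A) i j = a * A i j.
Proof. by rewrite mxE. Qed.

Lemma mulmx2E (A B : 'M[R]_2) i j :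
  (A *m B) i j = A i o0 * B o0 j + A i o1 * B o1 j.
Proof. by rewrite mxE !big_ord_recl big_ord0 addr0. Qed.

Lemma mulmx3E (A B : 'M[R]_3) i j :
  (A *m B) i j = A i o0 * B o0 j + A i o1 * B o1 j + A i o2 * B o2 j.
Proof. by rewrite mxE !big_ord_recl big_ord0 addr0 addrA. Qed.

Lemma gram1E :
  ((gram 1 o0 o0 = 1) * (gram 1 o0 o1 = 2)) *
  ((gram 1 o1 o0 = 0) * (gram 1 o1 o1 = 1)).
Proof. by do !split; rewrite mxE ?lift0. Qed.

Lemma gram2E :
  ((gram 2 o0 o0 = 1) * (gram 2 o0 o1 = 3) * (gram 2 o0 o2 = 6)) *
  ((gram 2 o1 o0 = 0) * (gram 2 o1 o1 = 1) * (gram 2 o1 o2 = 3)) *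
  ((gram 2 o2 o0 = 0) * (gram 2 o2 o1 = 0) * (gram 2 o2 o2 = 1)).
Proof. by do !split; rewrite mxE ?lift0. Qed.

Lemma twist_mx1E t (i : 'I_2) :
  (twist_mx 1 t i o0 = 1 - (t + i%:R)) * (twist_mx 1 t i o1 = t + i%:R).
Proof. by split; rewrite mxE ?lift0 lag1E. Qed.

Lemma twist_mx2E t (i : 'I_3) (u := t + i%:R) :
  (twist_mx 2 t i o0 = (u - 1) * (u - 2) / 2) *
  (twist_mx 2 t i o1 = u * (2 - u)) * (twist_mx 2 t i o2 = u * (u - 1) / 2).
Proof. by do !split; rewrite mxE ?lift0 lag2E. Qed.

Definition entriesE := (trmx_entry, scalemx_entry, mulmx2E, mulmx3E,
  gram1E, gram2E, twist_mx1E, twist_mx2E).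

(** The invariance of chi under integral twists, as an identity between polynomials in t. *)
Lemma twist_mx_isometry n t : n = 1%N \/ n = 2%N ->
  twist_mx n t *m gram n *m (twist_mx n t)^T = gram n.
Proof.
case=> ->; apply/matrixP.
  by apply: ord2_ind; apply: ord2_ind; rewrite !entriesE ?lift0 /=; ring.
by apply: ord3_ind; apply: ord3_ind; rewrite !entriesE ?lift0 /=; field.
Qed.

(* Serre duality: the Serre functor is E |-> E(-n-1)[n]. *)
Lemma gram_serre n : n = 1%N \/ n = 2%N ->
  (gram n)^T = (-1) ^+ n *: (twist_mx n n.+1%:R *m gram n).
Proof.
case=> ->; apply/matrixP.
  by apply: ord2_ind; apply: ord2_ind; rewrite !entriesE ?lift0 /=; ring.
by apply: ord3_ind; apply: ord3_ind; rewrite !entriesE ?lift0 /=; field.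
Qed.

(** The binomial vanishes for j < i and is 1 for j = i, so the matrix is unitriangular. *)
Lemma gram_unit n : gram n \in unitmx.
Proof.
rewrite -unitmx_tr unitmxE det_trig; last first.
  apply/is_trig_mxP => i j ij; rewrite !mxE bin_small //.
  by have := ltn_ord j; lia.
by rewrite big1 ?unitr1 // => i _; rewrite !mxE addnK binn.
Qed.

(** With G the Gram matrix and S the twist, A also preserves the transpose of G, which is S G up to
    sign. Hence A S G A^T = S G = S A G A^T, and G A^T cancels. *)
Lemma isometry_comm_twist n (A : 'M[R]_n.+1) : n = 1%N \/ n = 2%N ->
  A *m gram n *m A^T = gram n ->
  A *m twist_mx n n.+1%:R = twist_mx n n.+1%:R *m A.
Proof.
move=> hn Ag; set S := twist_mx n _.
have u : gram n *m A^T \in unitmx.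
  have := gram_unit n; rewrite -{1}Ag -mulmxA unitmx_mul.
  by case/andP.
have AgT : A *m (gram n)^T *m A^T = (gram n)^T.
  by rewrite -{2}Ag !trmx_mul trmxK mulmxA.
move: AgT; rewrite gram_serre // -/S -scalemxAr -scalemxAl.
have s0 : (-1) ^+ n != 0 :> R by rewrite signr_eq0.
move/(scalerI s0) => ASg.
apply: (can_inj (mulmxK u)).
by rewrite -!mulmxA [A *m (gram n *m _)]mulmxA Ag -ASg !mulmxA.
Qed.

Lemma isometry_twist n (A : 'M[R]_n.+1) : n = 1%N \/ n = 2%N ->
  A *m gram n *m A^T = gram n ->
  exists s b, s ^+ 2 = 1 /\ A = s *: twist_mx n b.
Proof.
move=> hn Ag; have := isometry_comm_twist hn Ag.
case: hn A Ag => -> A /matrixP Ag /matrixP Ac.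
  have := Ac o0 o0; have := Ac o0 o1; have := Ac o1 o0; have := Ac o1 o1.
  have := Ag o0 o0; have := Ag o0 o1.
  rewrite !entriesE ?lift0 /=.
  set x := A o0 o0; set y := A o0 o1; set z := A o1 o0; set w := A o1 o1.
  move=> q1 q2 l1 l2 l3 l4.
  (* The commutation equations are linear and express the lower row through the first. *)
  have ez : z = - y by lra.
  have ew : w = x + 2 * y by lra.
  (* s is the rank and b the degree of the image of O, up to the sign s. *)
  exists (x + y), (y * (x + y)).
  have s2 : (x + y) ^+ 2 = 1 by rewrite ez ew in q1 q2; nra.
  have ys : y * (x + y) ^+ 2 = y by rewrite s2 mulr1.
  split=> //; apply/matrixP.
  by apply: ord2_ind; apply: ord2_ind;
    rewrite !entriesE ?lift0 /= -?/x -?/y -?/z -?/w ?ez ?ew; lra.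
have := Ac o0 o0; have := Ac o0 o1; have := Ac o0 o2.
have := Ac o1 o0; have := Ac o1 o1; have := Ac o1 o2.
have := Ac o2 o0; have := Ac o2 o1; have := Ac o2 o2.
have := Ag o0 o0; have := Ag o0 o1; have := Ag o0 o2.
rewrite !entriesE ?lift0 /=.
set x := A o0 o0; set y := A o0 o1; set z := A o0 o2.
set x' := A o1 o0; set y' := A o1 o1; set z' := A o1 o2.
set x'' := A o2 o0; set y'' := A o2 o1; set z'' := A o2 o2.
move=> q1 q2 q3 l1 l2 l3 l4 l5 l6 l7 l8 l9.
have ex' : x' = z by lra.
have ey' : y' = x - 3 * z by lra.
have ez' : z' = y + 3 * z by lra.
have ex'' : x'' = y + 3 * z by lra.
have ey'' : y'' = - 3 * y - 8 * z by lra.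
have ez'' : z'' = x + 3 * y + 6 * z by lra.
rewrite ex' ey' ez' ex'' ey'' ez'' in q1 q2 q3.
(* Rank, and rank times degree, of the image of O; O(1) and O(2) have degrees 1 and 2. *)
exists (x + y + z), ((y + 2 * z) * (x + y + z)).
have s2 : (x + y + z) ^+ 2 = 1 by lra.
set c := y + 2 * z; set s := x + y + z in s2 *.
(* [lra] treats monomials as atoms, so the multiples of [s ^+ 2 = 1] it needs are supplied by
   hand. *)
have zs : z * s ^+ 2 = z by rewrite s2 mulr1.
have cs : c * s ^+ 2 = c by rewrite s2 mulr1.
have ccs : c ^+ 2 * s * s ^+ 2 = c ^+ 2 * s by rewrite s2 mulr1.
(* With b = c s, this says that the coefficient z of O(2) in the image of O is s b (b - 1) / 2. *)
have zc : 2 * (z * s) = c ^+ 2 - c * s by rewrite /c /s in s2 *; lra.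
have zcs : 2 * (z * s) * s = (c ^+ 2 - c * s) * s by rewrite zc.
rewrite /c /s in s2 zs cs ccs zcs *.
split=> //; apply/matrixP.
clear q1 q2 q3 l1 l2 l3 l4 l5 l6 l7 l8 l9 zc.
by apply: ord3_ind; apply: ord3_ind;
  rewrite !entriesE ?lift0 /= -?/x -?/y -?/z -?/x' -?/y' -?/z' -?/x'' -?/y''
    -?/z'' ?ex' ?ey' ?ez' ?ex'' ?ey'' ?ez''; lra.
Qed.

(** * Rank, degree and Euler characteristic of real twists *)

Lemma sum2E (F : 'I_2 -> R) : \sum_i F i = F o0 + F o1.
Proof. by rewrite !big_ord_recl big_ord0 addr0. Qed.

Lemma sum3E (F : 'I_3 -> R) : \sum_i F i = F o0 + F o1 + F o2.
Proof. by rewrite !big_ord_recl big_ord0 addr0 addrA. Qed.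

(** Interpolation reproduces the constant 1: O(t) has rank 1. In the next lemma it reproduces t, the
    degree. *)
Lemma sum_lag n t : n = 1%N \/ n = 2%N -> \sum_(j < n.+1) lag n t j = 1.
Proof.
by case=> ->; rewrite ?sum2E ?sum3E ?lift0 /= ?lag1E ?lag2E; field.
Qed.

Lemma sum_lag_degree n t : n = 1%N \/ n = 2%N ->
  \sum_(j < n.+1) j%:R * lag n t j = t.
Proof.
by case=> ->; rewrite ?sum2E ?sum3E ?lift0 /= ?lag1E ?lag2E; field.
Qed.

(** Both sides are chi(O(i), O(t)) continued to real t; these values determine the coordinates of
    O(t). *)
Lemma gram_lag n t (i : 'I_n.+1) : n = 1%N \/ n = 2%N ->
  \sum_(j < n.+1) gram n i j * lag n t j =
  (\prod_(k < n) (n%:R + t - i%:R - k%:R)) / n`!%:R.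
Proof.
move=> hn; case: hn i => ->.
  by apply: ord2_ind; rewrite sum2E !gram1E !lift0 /= !lag1E
    (_ : 1`! = 1%N) // ?big_ord_recl ?big_ord0 ?lift0 /=; field.
by apply: ord3_ind; rewrite sum3E !gram2E !lift0 /= !lag2E
  (_ : 2`! = 2%N) // ?big_ord_recl ?big_ord0 ?lift0 /=; field.
Qed.

(** * Continuity of the family of twists *)

Lemma twist_mx0 n : twist_mx n 0 = 1%:M :> 'M[R]_n.+1.
Proof.
apply/matrixP => i j; rewrite !mxE add0r /lag.
have [->|ij] := eqVneq i j; last first.
  by rewrite (bigD1 i) /= ?subrr ?mul0r.
apply: big1 => k kj; rewrite divff // subr_eq0 eqr_nat eq_sym.
exact: kj.
Qed.

Lemma lag_continuous n j : continuous (fun t : R => lag n t j).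
Proof.
pose p : {poly R} := \prod_(k < n.+1 | k != j :> nat)
  (('X - (k%:R)%:P) * ((j%:R - k%:R)^-1)%:P).
rewrite (_ : (fun t => _) = horner p); first exact: continuous_horner.
apply/funext => t; rewrite horner_prod; apply: eq_bigr => k _.
by rewrite !hornerE.
Qed.

Lemma twist_mx_continuous n : continuous (@twist_mx n).
Proof.
(* A neighbourhood of a matrix contains a product of neighbourhoods [P i j] of its finitely many
   entries. *)
move=> t A [P tP PA].
have : \forall u \near t, forall i j, P i j (twist_mx n u i j).
  apply: (@filter_forall _ _ (fun i u => forall j, P i j (twist_mx n u i j))
    _ (nbhs_filter t)) => i.
  apply: (@filter_forall _ _ (fun j u => P i j (twist_mx n u i j))
    _ (nbhs_filter t)) => j.
  have h : {for t, continuous (fun u => twist_mx n u i j)}.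
    rewrite (_ : (fun u => _) = (fun u => lag n u j) \o (fun u => u + i%:R)).
      apply: continuous_comp; last exact: lag_continuous.
      by apply: cvgD; [exact: cvg_id | exact: cvg_cst].
    by apply/funext => u; rewrite mxE.
  exact: h (tP i j).
by apply: filterS => u uP; exact: PA.
Qed.

(** * Real and integral isometries *)

Section Isom.
Context (n : nat) (K : K0_Pn n).

Lemma chiRE (u v : 'rV[R]_n.+1) : chiR K u v = (u *m gram n *m v^T) 0 0.
Proof.
rewrite mxE /chiR exchange_big; apply: eq_bigr => j _ /=.
rewrite !mxE mulr_suml; apply: eq_bigr => i _.
by rewrite mxE chi_twO_nat ?leq_ord // -pmulrn mulrAC.
Qed.

(** Pairing basis rows gives the matrix identity; conversely that identity makes A invertible, since
    [gram n] is. *)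
Lemma isom_K0RP (A : 'M[R]_n.+1) :
  isom_K0R R K A <-> A *m gram n *m A^T = gram n.
Proof.
have chiRA u v :
    chiR K (u *m A) (v *m A) = (u *m (A *m gram n *m A^T) *m v^T) 0 0.
  by rewrite chiRE trmx_mul !mulmxA.
split=> [[_ chiA]|Ag].
  have deltaE (B : 'M[R]_n.+1) i j :
      (delta_mx 0 i *m B *m (delta_mx 0 j)^T : 'M[R]_1) 0 0 = B i j.
    by rewrite trmx_delta -rowE -colE !mxE.
  by apply/matrixP => i j; rewrite -[LHS]deltaE -chiRA chiA chiRE deltaE.
split=> [|u v]; last by rewrite chiRA Ag chiRE.
have := gram_unit n; rewrite -{1}Ag unitmx_mul => /andP[].
by rewrite unitmx_mul => /andP[].
Qed.

Lemma chi_twO_real (k m : int) : (chi (twO K k) (twO K m))%:~R =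
  (\prod_(i < n) (n%:R + m%:~R - k%:~R - i%:R)) / n`!%:R :> R.
Proof.
rewrite -[LHS]ratr_int chi_twO /binq fmorph_div rmorph_prod /= ratr_nat.
congr (_ / _); apply: eq_bigr => i _.
by rewrite ratr_int !(rmorphB, rmorphD).
Qed.

Hypothesis hn : n = 1%N \/ n = 2%N.

(** Both columns have the same pairings with O(0), ..., O(n), and [gram n] is invertible. *)
Lemma coord_twO (m : int) (j : 'I_n.+1) :
  (coord (twO K m) 0 j)%:~R = lag n m%:~R j :> R.
Proof.
pose c : 'cV[R]_n.+1 := \col_j (coord (twO K m) 0 j)%:~R.
suff : c = \col_j lag n m%:~R j by move/colP/(_ j); rewrite !mxE.
apply: (can_inj (mulKmx (gram_unit n))); apply/colP => i.
rewrite [LHS]mxE [RHS]mxE; under [RHS]eq_bigr => k _ do rewrite [X in _ * X]mxE.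
rewrite [RHS]gram_lag //; have := chi_twO_real i m; rewrite -pmulrn => <-.
rewrite (K0_additiveE (@chiDr _ K _)) rmorph_sum; apply: eq_bigr => k _ /=.
by rewrite !mxE chi_twO_nat ?leq_ord // mulrzz rmorphM /= -pmulrn.
Qed.

Lemma extR_twist (k : int) :
  extR R (fun E : K => E * twO K k) = twist_mx n k%:~R.
Proof.
by apply/matrixP => i j; rewrite !mxE twO_mul coord_twO rmorphD addrC.
Qed.

Lemma twO_inj : injective (twO K).
Proof.
move=> k m km; apply: (@intr_inj R).
rewrite -[LHS](sum_lag_degree _ hn) -[RHS](sum_lag_degree _ hn).
by apply: eq_bigr => j _; rewrite -!coord_twO km.
Qed.

Lemma isom_e_K0RE : isom_e_K0R R K = range (twist_mx n).
Proof.
apply/seteqP; split=> [A Ae|]; last first.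
  apply: connected_component_max.
  - by exists 0 => //; exact: twist_mx0.
  - by move=> _ [t _ <-]; apply/isom_K0RP/twist_mx_isometry.
  - apply: connected_continuous_connected.
      by apply/connected_intervalP.
    exact/continuous_subspaceT/twist_mx_continuous.
(* The rank of the image of O under B, as every O(j) has rank 1. *)
pose rk (B : 'M[R]_n.+1) := \sum_j B 0 j.
have rkE s b : rk (s *: twist_mx n b) = s.
  rewrite /rk (eq_bigr (fun j : 'I_n.+1 => s * lag n b j)) => [|j _].
    by rewrite -mulr_sumr sum_lag // mulr1.
  by rewrite !mxE addr0.
have isomE B : isom_e_K0R R K B ->
    exists s b, s ^+ 2 = 1 /\ B = s *: twist_mx n b.
  by move/connected_component_sub/isom_K0RP; exact: isometry_twist.
have rk_continuous : continuous rk.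
  apply: continuous_big => [|j _]; [exact: add_continuous|].
  exact: coord_continuous.
have rk_int : is_interval (rk @` isom_e_K0R R K).
  apply/connected_intervalP/connected_continuous_connected.
    exact: component_connected.
  exact/continuous_subspaceT.
have [s [b [s2 AE]]] := isomE _ Ae.
have [s1|s_neg] : s = 1 \/ s = -1.
  by move/eqP: s2; rewrite sqrf_eq1 => /orP[]/eqP; [left|right].
  by exists b => //; rewrite AE s1 scale1r.
(* A rank of -1 at A and 1 at the identity would force rank 0 somewhere on the connected component,
   against [s' ^+ 2 = 1]. *)
suff [B /isomE[s' [b' [s'2 ->]]]] : (rk @` isom_e_K0R R K) 0.
  rewrite rkE => s'0; move: s'2; rewrite s'0 expr0n /= => /eqP.
  by rewrite eq_sym oner_eq0.
apply: (rk_int (- 1) 1).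
- by exists A => //; rewrite AE rkE.
- exists 1%:M; last by rewrite -(twist_mx0 n) -[X in rk X]scale1r rkE.
  apply: connected_component_refl; apply/isom_K0RP.
  by rewrite mul1mx trmx1 mulmx1.
- by rewrite oppr_le0 !ler01.
Qed.

Lemma isom_e_K0E :
  isom_e_K0 R K = range (fun (k : int) (E : K) => E * twO K k).
Proof.
apply/seteqP; split=> [f [[fD _ _]]|_ [k _ <-]]; last first.
  by split; [exact: twist_isom | rewrite isom_e_K0RE extR_twist; exists k%:~R].
rewrite isom_e_K0RE => -[b _ /matrixP fb].
(* The degree of f(O); it equals b because row 0 of [extR R f] holds the coordinates of O(b). *)
pose k := \sum_(j < n.+1) j%:Z * coord (f (twO K 0)) 0 j.
have bE : b = k%:~R.
  rewrite rmorph_sum -[LHS](sum_lag_degree _ hn); apply: eq_bigr => j _ /=.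
  have := fb ord0 j; rewrite !mxE addr0 => ->.
  by rewrite rmorphM /= -pmulrn.
exists k => //; apply/funext; apply: K0_additive_eq => // [E F|i].
  by rewrite mulrDl.
apply: coord_inj; apply/rowP => j; apply: (@intr_inj R).
have := fb i j; rewrite !mxE bE => <-.
by rewrite twO_mul coord_twO rmorphD addrC.
Qed.

End Isom.
End RealTwists.

(** * The cyclic group of integral twists *)

Lemma twists_transf_group n (K : K0_Pn n) :
  transf_group (range (fun (k : int) (E : K) => E * twO K k)).
Proof.
split=> [|_ _ [k _ <-] [m _ <-]|_ [k _ <-]].
- by exists 0 => //; apply/funext => E; rewrite twO0 mulr1.
- by exists (m + k) => //; apply/funext => E; rewrite /= -mulrA twO_mul.
- exists (fun E => E * twO K (- k)); split; first by exists (- k).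
    by move=> E; rewrite -mulrA twO_mul subrr twO0 mulr1.
  by move=> E; rewrite -mulrA twO_mul addNr twO0 mulr1.
Qed.

Lemma generated_by_twist n (K : K0_Pn n) :
  generated_by (twist K) = range (fun (k : int) (E : K) => E * twO K k).
Proof.
apply/seteqP; split.
  apply: smallest_sub; first exact: twists_transf_group.
  by move=> _ ->; exists 1.
move=> _ [k _ <-] G [[G1 GM GV] /(_ _ erefl) Gt].
(* The inverse of the twist in G is the twist by O(-1), so induction reaches k of either sign. *)
have [g [Gg tg gt]] := GV _ Gt.
have gE E : g E = E * twO K (- 1).
  by rewrite -[E in RHS]gt /twist -mulrA twO_mul subrr twO0 mulr1.
elim/int_rect: k => [|k IH|k IH].
- by rewrite (_ : (fun E => _) = id) //; apply/funext => E; rewrite twO0 mulr1.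
- rewrite (_ : (fun E => _) = twist K \o (fun E => E * twO K k)).
    exact: GM.
  by apply/funext => E; rewrite /twist /= -mulrA twO_mul -addn1 PoszD.
- rewrite (_ : (fun E => _) = g \o (fun E => E * twO K (- k%:Z))).
    exact: GM.
  apply/funext => E; rewrite /= gE -mulrA twO_mul.
  by rewrite -addn1 PoszD opprD.
Qed.

Theorem proposition9 (R : realType) (n : nat) (hn : n = 1%N \/ n = 2%N)
  (K : K0_Pn n) :
  [/\ transf_group (isom_e_K0 R K),
      isomorphic_to_Z (isom_e_K0 R K)
    & isom_e_K0 R K = generated_by (twist K)].
Proof.
rewrite generated_by_twist isom_e_K0E //; split=> //.
  exact: twists_transf_group.
exists (fun k E => E * twO K k); split=> [|a b]; last first.
  by apply/funext => E; rewrite /= -mulrA twO_mul addrC.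
split=> [k _|k m _ _ /(congr1 (fun f => f 1))|f [k _ <-]].
- by exists k.
- by rewrite !mul1r; exact: (twO_inj R hn).
- by exists k.
Qed.
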